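(* Let $\delta>0$. Then there exists $c=c(\delta)>0$ such that the following holds. Let $\alpha\in[0,\pi/2-\delta)$, and let $\mathcal{A}$ and $\mathcal{B}$ be finite sets of lines through the origin in a real Euclidean space such that the angle between $\ell_1$ and $\ell_2$ is $\alpha$ for every $(\ell_1,\ell_2)\in\mathcal{A}\times\mathcal{B}$. Then, for any choice of direction vectors $v_\ell$ (a nonzero vector spanning $\ell$) for every $\ell\in\mathcal{A}\cup\mathcal{B}$, there exist $\mathcal{A}'\subset\mathcal{A}$ and $\mathcal{B}'\subset\mathcal{B}$ with $|\mathcal{A}'|\geq c|\mathcal{A}|$ and $|\mathcal{B}'|\geq c|\mathcal{B}|$ such that either the angle between $v_{\ell_1}$ and $v_{\ell_2}$ is $\alpha$ for every $(\ell_1,\ell_2)\in\mathcal{A}'\times\mathcal{B}'$, or it is $\pi-\alpha$ for every $(\ell_1,\ell_2)\in\mathcal{A}'\times\mathcal{B}'$.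
   Context: The angle between two lines through the origin is the angle in $[0,\pi/2]$ between them; the angle between two nonzero vectors is in $[0,\pi]$. Thus if two lines make angle $\alpha$, their direction vectors make angle $\alpha$ or $\pi-\alpha$. *)

(* Defs.v *)
From HB Require Import structures.
From mathcomp Require Import all_boot all_order all_algebra finmap.
From mathcomp Require Import all_classical all_reals all_analysis.
From mathcomp Require Import ring.

Set Implicit Arguments.
Unset Strict Implicit.
Unset Printing Implicit Defensive.

Import Order.TTheory GRing.Theory Num.Theory.

Local Open Scope ring_scope.

Definition dotp (R : realType) (n : nat) (u v : 'rV[R]_n) : R :=
  \sum_(i < n) u 0 i * v 0 i.

Definition enorm (R : realType) (n : nat) (u : 'rV[R]_n) : R :=
  Num.sqrt (dotp u u).

(* In [0, pi]; only meaningful for nonzero u and v. *)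
Definition vangle (R : realType) (n : nat) (u v : 'rV[R]_n) : R :=
  acos (dotp u v / (enorm u * enorm v)).

Definition is_line (R : realType) (n : nat) (L : {vspace 'rV[R]_n}) : bool :=
  (\dim L == 1)%N.

Definition direction_vector (R : realType) (n : nat)
    (L : {vspace 'rV[R]_n}) (v : 'rV[R]_n) : Prop :=
  v != 0 /\ <[v]>%VS = L.

(* In [0, pi / 2]; vpick L is a nonzero vector of the line L, and the value
   does not depend on which one is used: see line_angleE. *)
Definition line_angle (R : realType) (n : nat)
    (L M : {vspace 'rV[R]_n}) : R :=
  let t := vangle (vpick L) (vpick M) in Num.min t (pi - t).

Section LineAngle.
Variables (R : realType) (n : nat).
Implicit Types (u v w : 'rV[R]_n) (L M : {vspace 'rV[R]_n}).

Lemma dotpC u v : dotp u v = dotp v u.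
Proof. by apply: eq_bigr => i _; rewrite mulrC. Qed.

Lemma dotpDl u v w : dotp (u + v) w = dotp u w + dotp v w.
Proof. by rewrite -big_split; apply: eq_bigr => i _; rewrite mxE mulrDl. Qed.

Lemma dotpZl a u v : dotp (a *: u) v = a * dotp u v.
Proof. by rewrite mulr_sumr; apply: eq_bigr => i _; rewrite mxE mulrA. Qed.

Lemma dotp_ge0 u : 0 <= dotp u u.
Proof. by apply: sumr_ge0 => i _; rewrite -expr2 sqr_ge0. Qed.

Lemma dotp_eq0 u : (dotp u u == 0) = (u == 0).
Proof.
apply/idP/eqP => [|->]; last first.
  by apply/eqP; apply: big1 => i _; rewrite mxE mul0r.
rewrite psumr_eq0 => [/allP u0|i _]; last by rewrite -expr2 sqr_ge0.
apply/rowP => i; have := u0 i (mem_index_enum _).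
by rewrite -expr2 sqrf_eq0 mxE => /eqP.
Qed.

Lemma enorm_gt0 u : u != 0 -> 0 < enorm u.
Proof. by move=> u0; rewrite sqrtr_gt0 lt_neqAle eq_sym dotp_eq0 u0 dotp_ge0. Qed.

Lemma enormZ a u : enorm (a *: u) = `|a| * enorm u.
Proof.
by rewrite /enorm dotpZl dotpC dotpZl mulrA -expr2 sqrtrM ?sqr_ge0// sqrtr_sqr.
Qed.

Lemma cauchy_schwarz u v : `|dotp u v| <= enorm u * enorm v.
Proof.
have [->|v0] := eqVneq v 0.
  rewrite dotpC -(scale0r (0 : 'rV[R]_n)) dotpZl mul0r normr0.
  by rewrite mulr_ge0 ?sqrtr_ge0.
have vv : 0 < dotp v v by rewrite lt_neqAle eq_sym dotp_eq0 v0 dotp_ge0.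
rewrite -sqrtrM ?dotp_ge0// -sqrtr_sqr ler_sqrt ?mulr_ge0 ?dotp_ge0//.
rewrite -subr_ge0 -(pmulr_rge0 _ vv).
have := dotp_ge0 (dotp v v *: u + (- dotp u v) *: v).
rewrite !(dotpDl, dotpZl) ![dotp _ (_ + _)]dotpC !(dotpDl, dotpZl) (dotpC v u).
by congr (_ <= _); ring.
Qed.

Lemma cos_vangle_itv u v : u != 0 -> v != 0 ->
  -1 <= dotp u v / (enorm u * enorm v) <= 1.
Proof.
move=> u0 v0; have uv : 0 < enorm u * enorm v by rewrite mulr_gt0 ?enorm_gt0.
rewrite -ler_norml normrM (gtr0_norm (x := _^-1)) ?invr_gt0//.
by rewrite ler_pdivrMr// mul1r cauchy_schwarz.
Qed.

Lemma vangleC u v : vangle u v = vangle v u.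
Proof. by rewrite /vangle dotpC (mulrC (enorm u)). Qed.

Lemma vangleZl a u v : a != 0 -> u != 0 -> v != 0 ->
  vangle (a *: u) v = if 0 < a then vangle u v else pi - vangle u v.
Proof.
move=> a0 u0 v0; rewrite /vangle dotpZl enormZ.
have -> : a * dotp u v / (`|a| * enorm u * enorm v) =
    Num.sg a * (dotp u v / (enorm u * enorm v)).
  rewrite -(mulrA `|a|) invfM mulrACA; congr (_ * _).
  by rewrite {1}[a]numEsg mulfK// normr_eq0.
case: ltrgt0P a0 => // a0 _; first by rewrite gtr0_sg// mul1r.
by rewrite ltr0_sg// mulN1r acosN// cos_vangle_itv.
Qed.

Lemma min_vangleZ a u v : a != 0 -> u != 0 -> v != 0 ->
  Num.min (vangle (a *: u) v) (pi - vangle (a *: u) v) =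
  Num.min (vangle u v) (pi - vangle u v).
Proof.
by move=> a0 u0 v0; rewrite vangleZl//; case: ifP => // _; rewrite subKr minC.
Qed.

Lemma direction_vector_vpick L u : direction_vector L u ->
  vpick L != 0 /\ exists2 a, a != 0 & vpick L = a *: u.
Proof.
move=> [u0 <-]; have p0 : vpick <[u]>%VS != 0.
  by rewrite vpick0 -dimv_eq0 dim_vline u0.
split=> //; have /vlineP[a pE] := memv_pick <[u]>%VS.
by exists a => //; apply: contraNneq p0 => a0; rewrite pE a0 scale0r.
Qed.

Lemma line_angleE L M u v : direction_vector L u -> direction_vector M v ->
  line_angle L M = Num.min (vangle u v) (pi - vangle u v).
Proof.
move=> Lu Mv; rewrite /line_angle.
have [p0 [a a0 pE]] := direction_vector_vpick Lu.
have [q0 [b b0 qE]] := direction_vector_vpick Mv.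
have [u0 _] := Lu; have [v0 _] := Mv.
by rewrite pE min_vangleZ// vangleC qE min_vangleZ// vangleC.
Qed.

End LineAngle.

(* Main.v *)
Require Import Defs.
From HB Require Import structures.
From mathcomp Require Import all_boot all_order all_algebra finmap.
From mathcomp Require Import all_classical all_reals all_analysis.
From mathcomp Require Import ring lra zify.

Set Implicit Arguments.
Unset Strict Implicit.
Unset Printing Implicit Defensive.

Import Order.TTheory GRing.Theory Num.Theory.

Local Open Scope fset_scope.
Local Open Scope ring_scope.

(**
Normalise the direction vectors, so that the inner product of v_k and v_l is
t or -t with t = cos alpha >= sin delta. A perceptron argument (at most
1 / sin(delta)^2 mistakes) gives a rectangle of positive proportion almost all
of whose signs agree; let M be the 0/1 matrix of the exceptional signs there.
It is sparse and M i j = <x_i, y_j> exactly, with bounded vectors.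

A sparse such M has an all-zero rectangle of positive proportion. Otherwise,
repeatedly take a row or column of largest relative degree among the uncovered
ones, say a row i, make its uncovered neighbourhood Q a cluster and cover Q.
Since column degrees are no larger, double counting shows that the rows having
density >= rho on Q form a proportion at most |Q| / (rho |C|); so when a
proportion about rho/8 of the columns is covered, most rows have density < rho
on every cluster. Replacing each y_j by its difference with the mean of its
cluster changes the products with these rows by O(rho + error), while it lowers
the squared norms: each mean has product close to 1 with x_i, hence is not
short. This cannot go on forever, the squared norms being nonnegative.
*)

(** * Inner products and means of vectors *)

Section InnerProduct.
Variables (F : realType) (n : nat).
Implicit Types u v w : 'rV[F]_n.

Lemma dotp0l v : dotp 0 v = 0.
Proof. by rewrite -(scale0r (0 : 'rV[F]_n)) dotpZl mul0r. Qed.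

Lemma dotpBl u v w : dotp (u - v) w = dotp u w - dotp v w.
Proof. by rewrite dotpDl -scaleN1r dotpZl mulN1r. Qed.

Lemma dotpBr u v w : dotp w (u - v) = dotp w u - dotp w v.
Proof. by rewrite !(dotpC w) dotpBl. Qed.

Lemma dotpDr u v w : dotp w (u + v) = dotp w u + dotp w v.
Proof. by rewrite !(dotpC w) dotpDl. Qed.

Lemma dotpZr a u v : dotp u (a *: v) = a * dotp u v.
Proof. by rewrite !(dotpC u) dotpZl. Qed.

Lemma dotp_suml (K : finType) (Q : {set K}) (y : K -> 'rV[F]_n) v :
  dotp (\sum_(k in Q) y k) v = \sum_(k in Q) dotp (y k) v.
Proof.
by apply: (big_morph (fun u => dotp u v) (fun a b => dotpDl a b v) (dotp0l v)).
Qed.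

Lemma dotp_sumr (K : finType) (Q : {set K}) (y : K -> 'rV[F]_n) v :
  dotp v (\sum_(k in Q) y k) = \sum_(k in Q) dotp v (y k).
Proof. by rewrite dotpC dotp_suml; apply: eq_bigr => k _; rewrite dotpC. Qed.

Lemma sqr_dotp_le u v : dotp u v ^+ 2 <= dotp u u * dotp v v.
Proof.
have h := cauchy_schwarz u v.
rewrite -real_normK ?num_real//.
rewrite -[leRHS]sqr_sqrtr ?mulr_ge0 ?dotp_ge0// sqrtrM ?dotp_ge0//.
by rewrite lerXn2r ?nnegrE ?normr_ge0 ?mulr_ge0 ?sqrtr_ge0.
Qed.

Definition mean (K : finType) (Q : {set K}) (y : K -> 'rV[F]_n) : 'rV[F]_n :=
  #|Q|%:R^-1 *: \sum_(k in Q) y k.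

Lemma card_scale_mean (K : finType) (Q : {set K}) (y : K -> 'rV[F]_n) :
  #|Q|%:R *: mean Q y = \sum_(k in Q) y k.
Proof.
have [->|Q0] := eqVneq Q finset.set0.
  by rewrite cards0 scale0r big_set0.
by rewrite /mean scalerA divff ?scale1r// pnatr_eq0 cards_eq0.
Qed.

(** Steiner's identity, the source of the energy decrement: centring a cluster pays off as soon as
    its mean is not short. *)
Lemma sum_sqdist_mean (K : finType) (Q : {set K}) (y : K -> 'rV[F]_n) :
  \sum_(k in Q) dotp (y k - mean Q y) (y k - mean Q y) =
  \sum_(k in Q) dotp (y k) (y k) - #|Q|%:R * dotp (mean Q y) (mean Q y).
Proof.
set m := mean Q y.
have -> : \sum_(k in Q) dotp (y k - m) (y k - m) =
    \sum_(k in Q) (dotp (y k) (y k) + (dotp m m - 2 * dotp (y k) m)).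
  by apply: eq_bigr => k _; rewrite !dotpBl !dotpBr (dotpC m (y k)); ring.
rewrite big_split big_split /= sumr_const sumrN -mulr_sumr -dotp_suml.
by rewrite -card_scale_mean -/m dotpZl -mulr_natl; ring.
Qed.

End InnerProduct.

(** Appending one coordinate shifts all products by a constant; this later turns the values t and -t
    into 0 and 1. *)
Lemma dotp_row_mx (F : realType) (m n : nat)
    (a c : 'rV[F]_m) (b d : 'rV[F]_n) :
  dotp (row_mx a b) (row_mx c d) = dotp a c + dotp b d.
Proof.
rewrite /dotp big_split_ord /=; congr (_ + _); apply: eq_bigr => i _.
  by rewrite !row_mxEl.
by rewrite !row_mxEr.
Qed.

(** * Counting the ones of a 0/1 matrix *)

Lemma card_setIdE (K : finType) (Q : {set K}) (p : pred K) :
  #|[set k in Q | p k]| = (\sum_(k in Q) p k)%N.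
Proof.
rewrite -sum1_card (eq_bigl (fun k => (k \in Q) && p k)); last first.
  by move=> k; rewrite inE.
by rewrite big_mkcondr; apply: eq_bigr => k _; case: (p k).
Qed.

Lemma double_count (I J : finType) (M : I -> J -> bool)
    (A : {set I}) (Q : {set J}) :
  (\sum_(i in A) #|[set k in Q | M i k]| =
   \sum_(k in Q) #|[set i in A | M i k]|)%N.
Proof.
under eq_bigr do rewrite card_setIdE.
by rewrite exchange_big; apply: eq_bigr => k _; rewrite card_setIdE.
Qed.

(** * Clusters formed from neighbourhoods *)

Section Clusters.
Variables (F : realType) (rho : F).

(* Each row outside P and B meets every cluster, i.e. every fibre of b on U,
   in a proportion at most rho. The neighbourhood of each centre b j is
   exhausted by U, so a centre is never chosen twice. *)
Definition clustering (I J : finType) (M : I -> J -> bool)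
    (R : {set I}) (C : {set J}) (P : {set I}) (U : {set J})
    (b : J -> I) (B : {set I}) : Prop :=
  [/\ U \subset C,
      forall j, j \in U -> b j \in R /\ M (b j) j,
      forall j k, j \in U -> k \in C -> M (b j) k -> k \in U,
      rho * #|B|%:R * #|C|%:R <= #|R|%:R * #|U|%:R &
      forall i j, i \in R :\: P -> i \notin B -> j \in U ->
        #|[set k in U | (b k == b j) && M i k]|%:R
          <= rho * #|[set k in U | b k == b j]|%:R].

Lemma clustering_weaken (I J : finType) (M : I -> J -> bool)
    (R : {set I}) (C : {set J}) (P P' : {set I}) (U : {set J}) b B :
  P \subset P' ->
  clustering M R C P U b B -> clustering M R C P' U b B.
Proof.
move=> PP' [h1 h2 h3 h4 h5]; split=> // i j iR; apply: h5.
by apply: fintype.subsetP iR; apply: finset.setDS.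
Qed.

(** The last hypothesis, cross-multiplied, says that no uncovered column has larger relative degree
    than row [i0]. Counting by columns the ones of the rows [H] that are dense on the new cluster
    [Q] gives |H| <= |R| |Q| / (rho |C|), so [B] can absorb [H]. *)
Lemma clustering_step (I J : finType) (M : I -> J -> bool)
    (R : {set I}) (C : {set J}) (P : {set I}) (U : {set J}) b B i0 :
  0 < rho -> clustering M R C P U b B -> i0 \in R ->
  (forall j, j \in C :\: U ->
     (#|[set i in R :\: P | M i j]| * #|C|
        <= #|[set k in C :\: U | M i0 k]| * #|R|)%N) ->
  exists b' B',
    clustering M R C P (U :|: [set k in C :\: U | M i0 k]) b' B'.
Proof.
move=> rho0 [h1 h2 h3 h4 h5] i0R; set Q := [set k in C :\: U | M i0 k] => hQ.
have QP j : j \in Q -> [/\ j \in C, j \notin U & M i0 j].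
  by rewrite !inE => /andP[/andP[]].
pose H := [set i in R :\: P | rho * #|Q|%:R < #|[set k in Q | M i k]|%:R].
exists (fun j => if j \in Q then i0 else b j), (B :|: H); split.
- rewrite finset.subUset h1; apply/fintype.subsetP => j /QP[] //.
- move=> j; rewrite finset.in_setU; case: ifP => [/QP[? ? ?] //|jQ].
  by rewrite orbF => /h2.
- move=> j k; rewrite !finset.in_setU => jUQ kC.
  have [kU|kU] //= := boolP (k \in U).
  case: ifP jUQ => [_ _ Mk|jQ]; first by rewrite !inE kU kC.
  rewrite orbF => jU Mk; have := h3 _ _ jU kC Mk; by rewrite (negPf kU).
- have hH : rho * #|H|%:R * #|C|%:R <= #|R|%:R * #|Q|%:R.
    have [Q0|Q0] := eqVneq Q finset.set0.
      suff -> : H = finset.set0 by rewrite cards0 mulr0 mul0r mulr_ge0.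
      apply/finset.setP => i; rewrite !inE; apply/negbTE; rewrite negb_and orbC.
      by rewrite -leNgt Q0 cards0 mulr0 card_setIdE big_set0 lexx.
    have Qp : 0 < #|Q|%:R :> F by rewrite ltr0n card_gt0.
    have e1 : rho * #|Q|%:R * #|H|%:R <= (\sum_(i in H) #|[set k in Q | M i k]|)%:R.
      rewrite natr_sum mulr_natr -sumr_const; apply: ler_sum => i.
      by rewrite inE => /andP[_ /ltW].
    have e2 : (\sum_(i in H) #|[set k in Q | M i k]| <=
        \sum_(i in R :\: P) #|[set k in Q | M i k]|)%N.
      rewrite [leqRHS](big_setID H) /= (finset.setIidPr _) ?leq_addr//.
      by apply/fintype.subsetP => i; rewrite inE => /andP[].
    have e3 : ((\sum_(i in R :\: P) #|[set k in Q | M i k]|) * #|C| <=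
        #|Q| * (#|Q| * #|R|))%N.
      rewrite double_count big_distrl /= -sum_nat_const.
      by apply: leq_sum => k; rewrite inE => /andP[kCU _]; apply: hQ.
    have {}e3 := leq_trans (leq_mul e2 (leqnn #|C|)) e3.
    have {e1} e1 := ler_wpM2r (ler0n F #|C|) e1.
    rewrite -(ler_pM2l Qp).
    move: e3; rewrite -(ler_nat F) !natrM => /(le_trans e1).
    by congr (_ <= _); ring.
  have -> : #|U :|: Q| = (#|U| + #|Q|)%N.
    rewrite finset.cardsU (_ : U :&: Q = finset.set0) ?cards0 ?subn0//.
    by apply/finset.setP => k; rewrite !inE; case: (k \in U); rewrite ?andbF.
  have cBH : (#|B :|: H| <= #|B| + #|H|)%N by rewrite finset.cardsU leq_subr.
  have : rho * #|B :|: H|%:R * #|C|%:R <= rho * (#|B|%:R + #|H|%:R) * #|C|%:R.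
    by rewrite ler_wpM2r// ler_wpM2l ?(ltW rho0)// -natrD ler_nat.
  rewrite natrD; lra.
- move=> i j iR; rewrite !finset.in_setU negb_or => /andP[iB iH] jUQ.
  have iHle : #|[set k in Q | M i k]|%:R <= rho * #|Q|%:R.
    by move: iH; rewrite inE iR /= -leNgt.
  have [jQ|jQ] := boolP (j \in Q).
    (* Had [i0] been the centre of an old cluster, closure would put [j] into [U]; so the fibre of
       [i0] is [Q] alone. *)
    have e : [set k in U :|: Q | (if k \in Q then i0 else b k) == i0] = Q.
      apply/finset.setP => k; rewrite inE finset.in_setU.
      case kQ: (k \in Q); rewrite ?orbT ?eqxx ?orbF//.
      apply/negP => /andP[kU /eqP bk]; have [jC jU Mj] := QP _ jQ.
      by have := h3 _ _ kU jC; rewrite bk Mj (negPf jU) => /(_ isT).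
    rewrite e; apply: le_trans iHle; rewrite ler_nat subset_leq_card//.
    apply/fintype.subsetP => k; rewrite inE => /and3P[k1 k2 k3].
    by rewrite inE k3 andbT -e inE k1.
  have jU : j \in U by move: jUQ; rewrite (negPf jQ) orbF.
  have e : [set k in U :|: Q | (if k \in Q then i0 else b k) == b j] =
           [set k in U | b k == b j].
    apply/finset.setP => k; rewrite inE finset.in_setU [RHS]inE.
    have [kQ|kQ] := boolP (k \in Q); last by rewrite orbF.
    have [kC kU Mk] := QP _ kQ; rewrite (negPf kU) /=.
    apply/negP => /eqP bk.
    by have := h3 _ _ jU kC; rewrite -bk Mk (negPf kU) => /(_ isT).
  rewrite e; apply: le_trans (h5 _ _ iR iB jU); rewrite ler_nat.
  apply: subset_leq_card; apply/fintype.subsetP => k.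
  rewrite inE => /and3P[k1 k2 k3].
  have : k \in [set k in U | b k == b j] by rewrite -e inE k1.
  by rewrite inE => /andP[kU /eqP bk]; rewrite inE kU bk eqxx.
Qed.
End Clusters.

(** * Greedy covering of rows or columns *)

Section Greedy.
Variables (F : realType) (rho : F).

Definition dense_cover (I J : finType) (M : I -> J -> bool)
    (R : {set I}) (C : {set J}) (R0 : {set I}) (U : {set J})
    (b : J -> I) : Prop :=
  [/\ (R0 \subset R) && (U \subset C), (#|R| <= 2 * #|R0|)%N,
      rho / 8 * #|C|%:R <= #|U|%:R,
      forall j, j \in U -> b j \in R /\ M (b j) j &
      forall i j, i \in R0 -> j \in U ->
        #|[set k in U | (b k == b j) && M i k]|%:R
          <= rho * #|[set k in U | b k == b j]|%:R].

(** Since |U| <= rho |C| / 4, the invariant bounds [B] by a quarter of the rows; [P] is at most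
    another quarter, so half of [R] survives. *)
Lemma clustering_dense_cover (I J : finType) (M : I -> J -> bool)
    (R : {set I}) (C : {set J}) (P : {set I}) (U : {set J}) b B :
  0 < rho <= 1 -> (0 < #|C|)%N -> clustering rho M R C P U b B ->
  rho / 8 * #|C|%:R <= #|U|%:R -> #|U|%:R <= rho / 4 * #|C|%:R ->
  #|P|%:R <= rho / 4 * #|R|%:R ->
  exists R0 U b, dense_cover M R C R0 U b.
Proof.
move=> /andP[rho0 rho1] C0 [h1 h2 h3 h4 h5] Ug Ul Pl.
exists (R :\: P :\: B), U, b; split=> //.
- by rewrite h1 andbT !finset.subDset finset.setUA finset.subsetUr.
- have cB : #|B|%:R <= #|R|%:R / 4 :> F.
    have C0' : 0 < #|C|%:R :> F by rewrite ltr0n.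
    rewrite -(ler_pM2l rho0) -(ler_pM2r C0').
    apply: le_trans h4 _; apply: le_trans (ler_wpM2l (ler0n _ _) Ul) _.
    lra.
  have e : (#|R| <= #|R :\: P :\: B| + #|P| + #|B|)%N.
    rewrite -(cardsID P R) -(cardsID B (R :\: P)).
    have := subset_leq_card (finset.subsetIr R P).
    have := subset_leq_card (finset.subsetIr (R :\: P) B).
    lia.
  rewrite -(ler_nat F) natrM.
  move: e; rewrite -(ler_nat F) !natrD => e.
  have : rho / 4 * #|R|%:R <= 1 / 4 * #|R|%:R by rewrite ler_wpM2r// ler_pM2r.
  lra.
- move=> i j iR; apply: h5; first by move: iR; rewrite inE => /andP[].
  by move: iR; rewrite inE => /andP[].
Qed.

(** Columns and rows are clustered simultaneously, the cover of each side being the discarded set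
    [P] of the other, until one cover reaches proportion rho / 8. Sparsity keeps a single step from
    overshooting rho / 4. *)
Lemma greedy_cover (I J : finType) (M : I -> J -> bool)
    (R : {set I}) (C : {set J}) :
  0 < rho <= 1 ->
  (forall i, i \in R -> #|[set k in C | M i k]|%:R <= rho / 8 * #|C|%:R) ->
  (forall j, j \in C -> #|[set i in R | M i j]|%:R <= rho / 8 * #|R|%:R) ->
  (forall (R0 : {set I}) (C0 : {set J}), R0 \subset R -> C0 \subset C ->
     (#|R| <= 2 * #|R0|)%N -> (#|C| <= 2 * #|C0|)%N ->
     exists i j, [/\ i \in R0, j \in C0 & M i j]) ->
  (exists R0 U b, dense_cover M R C R0 U b) \/
  (exists C0 V a, dense_cover (fun j i => M i j) C R C0 V a).
Proof.
move=> rho01 sR sC nz; have /andP[rho0 rho1] := rho01.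
have [i1 [j1 [i1R j1C _]]] :=
  nz R C (fintype.subxx R) (fintype.subxx C)
    (leq_pmull #|R| (ltn0Sn 1)) (leq_pmull #|C| (ltn0Sn 1)).
have R0 : (0 < #|R|)%N by apply/card_gt0P; exists i1.
have C0 : (0 < #|C|)%N by apply/card_gt0P; exists j1.
suff main : forall m (P : {set I}) (U : {set J}) b B a B',
    (#|C :\: U| + #|R :\: P| < m)%N ->
    clustering rho M R C P U b B ->
    clustering rho (fun j i => M i j) C R U P a B' ->
    #|U|%:R <= rho / 4 * #|C|%:R -> #|P|%:R <= rho / 4 * #|R|%:R ->
    (exists R0 U b, dense_cover M R C R0 U b) \/
    (exists C0 V a, dense_cover (fun j i => M i j) C R C0 V a).
  have hr n : 0 <= rho / 4 * n%:R by rewrite mulr_ge0// divr_ge0// ltW.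
  apply: (main _ finset.set0 finset.set0 (fun=> i1) finset.set0 (fun=> j1)
    finset.set0 (ltnSn _)); rewrite ?cards0//.
    by split=> [|j|j k|//|i j _ _]; rewrite ?finset.sub0set ?inE// !cards0 !mulr0 mul0r.
  by split=> [|j|j k|//|i j _ _]; rewrite ?finset.sub0set ?inE// !cards0 !mulr0 mul0r.
elim=> [//|m IH] P U b B a B' hm clU clP Ul Pl.
have [Ug|Ug] := leP (rho / 8 * #|C|%:R) #|U|%:R.
  by left; apply: clustering_dense_cover clU _ _ _.
have [Pg|Pg] := leP (rho / 8 * #|R|%:R) #|P|%:R.
  by right; apply: clustering_dense_cover clP _ _ _.
have [UC _ _ _ _] := clU; have [PR _ _ _ _] := clP.
have half (K : finType) (X Y : {set K}) : X \subset Y ->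
    #|X|%:R <= rho / 4 * #|Y|%:R -> (#|Y| <= 2 * #|Y :\: X|)%N.
  move=> XY hX; rewrite cardsD (finset.setIidPr XY).
  suff : (2 * #|X| <= #|Y|)%N by have := subset_leq_card XY; clear; lia.
  rewrite -(ler_nat F) natrM.
  have : rho / 4 * #|Y|%:R <= 1 / 4 * #|Y|%:R by rewrite ler_wpM2r// ler_pM2r.
  have := ler0n F #|Y|; lra.
(* At least half of each side is uncovered, so an uncovered one exists; both maximal degrees below
   are then positive and every step makes progress. *)
have [i2 [j2 [i2R j2C M2]]] := nz _ _ (finset.subsetDl R P)
  (finset.subsetDl C U) (half _ _ _ PR Pl) (half _ _ _ UC Ul).
case: (@arg_maxnP _ i2 (mem (R :\: P))
  (fun i => #|[set k in C :\: U | M i k]|)) => //= i0 i0R i0max.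
case: (@arg_maxnP _ j2 (mem (C :\: U))
  (fun j => #|[set i in R :\: P | M i j]|)) => //= j0 j0C j0max.
have i0pos : (0 < #|[set k in C :\: U | M i0 k]|)%N.
  by apply: leq_trans (i0max _ i2R); apply/card_gt0P; exists j2; rewrite inE j2C.
have j0pos : (0 < #|[set i in R :\: P | M i j0]|)%N.
  by apply: leq_trans (j0max _ j2C); apply/card_gt0P; exists i2; rewrite inE i2R.
have grow (K : finType) (X Y : {set K}) (p : pred K) : X \subset Y ->
    #|[set k in Y | p k]|%:R <= rho / 8 * #|Y|%:R ->
    #|X|%:R < rho / 8 * #|Y|%:R ->
    #|X :|: [set k in Y :\: X | p k]|%:R <= rho / 4 * #|Y|%:R.
  move=> XY h1 h2.
  have : (#|X :|: [set k in Y :\: X | p k]| <= #|X| + #|[set k in Y | p k]|)%N.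
    rewrite finset.cardsU; apply: leq_trans (leq_subr _ _) _.
    rewrite leq_add2l subset_leq_card//; apply/fintype.subsetP => k.
    by rewrite !inE => /andP[/andP[_ ->] ->].
  rewrite -(ler_nat F) natrD; lra.
have less (K : finType) (X Y : {set K}) (p : pred K) :
    (0 < #|[set k in Y :\: X | p k]|)%N ->
    (#|Y :\: (X :|: [set k in Y :\: X | p k])| < #|Y :\: X|)%N.
  case/card_gt0P => k; rewrite !inE => /andP[/andP[kX kY] pk].
  apply: proper_card; apply/properP; split.
    by rewrite finset.setDS// finset.subsetUl.
  by exists k; rewrite !inE kX kY ?pk ?orbT.
(* The larger of the two maximal relative degrees decides which clustering grows. The other stays
   valid, as it then constrains fewer lines. *)
have [le|/ltnW le] := leqP (#|[set i in R :\: P | M i j0]| * #|C|)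
                           (#|[set k in C :\: U | M i0 k]| * #|R|).
- have i0R' : i0 \in R by move: i0R; rewrite inE => /andP[].
  have [b' [B1 cl']] : exists b' B', clustering rho M R C P
      (U :|: [set k in C :\: U | M i0 k]) b' B'.
    apply: clustering_step clU i0R' _ => // j jC.
    by apply: leq_trans le; rewrite leq_mul2r j0max// orbT.
  apply: IH cl' (clustering_weaken (finset.subsetUl _ _) clP) _ Pl.
    by move: (less _ _ _ _ i0pos) hm; clear; lia.
  by apply: grow => //; apply: sR.
- have j0C' : j0 \in C by move: j0C; rewrite inE => /andP[].
  have [a' [B1 cl']] : exists a' B', clustering rho (fun j i => M i j) C R U
      (P :|: [set k in R :\: P | M k j0]) a' B'.
    apply: clustering_step clP j0C' _ => // i iR.
    by apply: leq_trans le; rewrite leq_mul2r i0max// orbT.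
  apply: IH (clustering_weaken (finset.subsetUl _ _) clU) cl' Ul _.
    by move: (less _ _ _ _ j0pos) hm; clear; lia.
  by apply: grow => //; apply: sC.
Qed.

End Greedy.

(** * Energy decrement by centring clusters *)

Section EnergyDecrement.
Variable F : realType.

Definition factors (I J : finType) (M : I -> J -> bool) (n : nat)
    (x : I -> 'rV[F]_n) (y : J -> 'rV[F]_n) (R : {set I}) (C : {set J})
    (eps X Y : F) : Prop :=
  [/\ forall i, i \in R -> dotp (x i) (x i) <= X,
      forall j, j \in C -> dotp (y j) (y j) <= Y &
      forall i j, i \in R -> j \in C ->
        `|dotp (x i) (y j) - (M i j)%:R| <= eps].

Lemma factors_tr (I J : finType) (M : I -> J -> bool) (n : nat)
    (x : I -> 'rV[F]_n) (y : J -> 'rV[F]_n) (R : {set I}) (C : {set J}) eps X Y :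
  factors M x y R C eps X Y -> factors (fun j i => M i j) y x C R eps Y X.
Proof. by case=> h1 h2 h3; split=> // j i jC iR; rewrite dotpC; apply: h3. Qed.

(** Averaged over [Q], the approximation says that the product with the mean is the density of row
    [i] on [Q] up to [eps]; clearing the denominator also covers empty [Q]. *)
Lemma mean_row (I J : finType) (M : I -> J -> bool) (n : nat)
    (x : I -> 'rV[F]_n) (y : J -> 'rV[F]_n) (R : {set I}) (C : {set J})
    eps X Y (Q : {set J}) i :
  factors M x y R C eps X Y -> Q \subset C -> i \in R ->
  `|#|Q|%:R * dotp (x i) (mean Q y) - #|[set k in Q | M i k]|%:R|
    <= #|Q|%:R * eps.
Proof.
case=> _ _ h /fintype.subsetP QC iR.
rewrite -dotpZr card_scale_mean dotp_sumr card_setIdE natr_sum -sumrB.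
apply: le_trans (ler_norm_sum _ _ _) _.
by rewrite mulr_natl -sumr_const; apply: ler_sum => k /QC; apply: h.
Qed.

(* If most of U had energy above Y - 1/(8G) after centring, the mean energy
   over U could not be at most Y - 1/(4G). *)
Lemma low_energy_card (J : finType) (U : {set J}) (f : J -> F) (G Y : F) :
  0 < G -> Y <= G -> (forall j, 0 <= f j) ->
  \sum_(j in U) f j <= #|U|%:R * (Y - 1 / (4 * G)) ->
  #|U|%:R <= 8 * G ^+ 2 * #|[set j in U | f j <= Y - 1 / (8 * G)]|%:R.
Proof.
move=> G0 YG f0 hs; set C' := [set j in U | _].
have CU : C' \subset U by apply/fintype.subsetP => j; rewrite inE => /andP[].
have cU : #|U|%:R = #|C'|%:R + #|U :\: C'|%:R :> F.
  by rewrite -natrD -(cardsID C' U) (finset.setIidPr CU).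
have : #|U :\: C'|%:R * (Y - 1 / (8 * G)) <= \sum_(j in U) f j.
  rewrite (big_setID C') /= -[leLHS]add0r; apply: lerD; first exact: sumr_ge0.
  rewrite mulr_natl -sumr_const; apply: ler_sum => j.
  by rewrite !inE => /andP[jC jU]; move: jC; rewrite jU /= -ltNge => /ltW.
move=> /le_trans/(_ hs); rewrite cU.
set c := #|C'|%:R; set d := #|U :\: C'|%:R.
have c0 : 0 <= c by apply: ler0n.
have e4 : 1 / (4 * G) = 2 * (1 / (8 * G)) by field; lra.
have e8 : 8 * G * (1 / (8 * G)) = 1 by field; lra.
rewrite e4; set g := 1 / (8 * G) in e8 *.
have g0 : 0 < g by rewrite divr_gt0// mulr_gt0.
move=> h; have h' : d * g <= c * (G - 2 * g).
  have : c * (Y - 2 * g) <= c * (G - 2 * g) by apply: ler_wpM2l => //; lra.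
  lra.
have h2 : (c + d) * g <= c * G.
  have : 0 <= c * g by rewrite mulr_ge0// ltW.
  lra.
have G8 : 0 < 8 * G by rewrite mulr_gt0.
have := ler_wpM2l (ltW G8) h2.
rewrite (_ : 8 * G * ((c + d) * g) = (8 * G * g) * (c + d)); last by ring.
by rewrite e8 mul1r (_ : 8 * G * (c * G) = 8 * G ^+ 2 * c)//; ring.
Qed.

Lemma energy_decrement (I J : finType) (M : I -> J -> bool) (n : nat)
    (x : I -> 'rV[F]_n) (y : J -> 'rV[F]_n) (R R0 : {set I}) (C U : {set J})
    b rho eps X Y G :
  dense_cover rho M R C R0 U b -> factors M x y R C eps X Y ->
  0 < G -> X <= G -> Y <= G -> eps <= 1 / 2 ->
  exists (C' : {set J}) y', [/\ C' \subset U,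
    #|U|%:R <= 8 * G ^+ 2 * #|C'|%:R &
    factors M x y' R0 C' (2 * eps + rho) X (Y - 1 / (8 * G))].
Proof.
move=> [/andP[R0R UC] _ _ bU sparse] fac G0 XG YG eps2.
have [hX hY hM] := fac.
pose cls i := [set k in U | b k == i].
have clsC i : cls i \subset C.
  by apply: fintype.subset_trans UC; apply/fintype.subsetP => k; rewrite inE => /andP[].
pose y' j := y j - mean (cls (b j)) y.
have clsP j : j \in U -> 0 < #|cls (b j)|%:R :> F.
  by move=> jU; rewrite ltr0n; apply/card_gt0P; exists j; rewrite inE jU eqxx.
(* A centre has density 1 on its own cluster, so its product with the mean is at least 1 - eps >=
   1/2; Cauchy-Schwarz then bounds the mean from below. *)
have mean_big j : j \in U ->
    1 / (4 * G) <= dotp (mean (cls (b j)) y) (mean (cls (b j)) y).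
  move=> jU; have [bR _] := bU _ jU; set m := mean _ _.
  have := mean_row fac (clsC (b j)) bR; rewrite -/m.
  have -> : [set k in cls (b j) | M (b j) k] = cls (b j).
    apply/finset.setP => k; rewrite !inE andbC.
    case kU: (k \in U); rewrite ?andbF//=; have [_] := bU _ kU.
    by case: eqVneq => [<- ->|_]; rewrite ?andbF.
  have q0 := clsP _ jU; set q := #|_|%:R in q0 *.
  have -> : q * dotp (x (b j)) m - q = q * (dotp (x (b j)) m - 1) by ring.
  rewrite normrM gtr0_norm// ler_pM2l// ler_norml => /andP[h _].
  have h2 : 1 / 2 <= dotp (x (b j)) m by lra.
  have := sqr_dotp_le (x (b j)) m.
  have : (1 / 2) ^+ 2 <= dotp (x (b j)) m ^+ 2.
    by rewrite lerXn2r// nnegrE; lra.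
  move=> /le_trans h3 /h3; have mm := dotp_ge0 m.
  move=> /le_trans/(_ (ler_wpM2r mm (le_trans (hX _ bR) XG))) {}h3.
  rewrite ler_pdivrMr ?mulr_gt0//; lra.
have sumU (f : J -> F) : \sum_(j in U) f j = \sum_i \sum_(j in cls i) f j.
  rewrite (partition_big b predT)//=; apply: eq_bigr => i _.
  by apply: eq_bigl => j; rewrite inE.
have energy : \sum_(j in U) dotp (y' j) (y' j) <= #|U|%:R * (Y - 1 / (4 * G)).
  rewrite mulr_natl -sumr_const !sumU; apply: ler_sum => i _.
  have [c0|[j jc]] := set_0Vmem (cls i); first by rewrite c0 !big_set0.
  move: (jc); rewrite inE => /andP[jU /eqP bj].
  have -> : \sum_(k in cls i) dotp (y' k) (y' k) =
      \sum_(k in cls i) dotp (y k - mean (cls i) y) (y k - mean (cls i) y).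
    by apply: eq_bigr => k; rewrite inE => /andP[_ /eqP bk]; rewrite /y' bk.
  rewrite sum_sqdist_mean sumr_const -[leRHS]mulr_natl mulrBr; apply: lerB.
    rewrite mulr_natl -sumr_const; apply: ler_sum => k /(fintype.subsetP (clsC i)).
    exact: hY.
  by rewrite ler_wpM2l// -bj mean_big.
(* Only half of the average gain 1/(4G) is demanded, so that a positive proportion of [U] attains
   it. *)
exists [set j in U | dotp (y' j) (y' j) <= Y - 1 / (8 * G)], y'; split.
- by apply/fintype.subsetP => j; rewrite inE => /andP[].
- by apply: low_energy_card => // j; apply: dotp_ge0.
split=> [i /(fintype.subsetP R0R)/hX//|j|i j iR0].
  by rewrite inE => /andP[].
rewrite inE => /andP[jU _]; have iR := fintype.subsetP R0R _ iR0.
have h1 := hM _ _ iR (fintype.subsetP UC _ jU).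
have := mean_row fac (clsC (b j)) iR.
have -> : [set k in cls (b j) | M i k] = [set k in U | (b k == b j) && M i k].
  by apply/finset.setP => k; rewrite !inE andbA.
have := sparse _ _ iR0 jU; rewrite -/(cls (b j)).
have q0 := clsP _ jU; set q := #|_|%:R in q0 *.
set s := #|_|%:R; set m := mean _ _ => sq hm.
have s0 : 0 <= s by apply: ler0n.
(* The density of row [i] on the cluster is at most [rho], and replacing it by the product costs
   [eps]. *)
have h2 : `|dotp (x i) m| <= eps + rho.
  rewrite -(ler_pM2l q0) -[X in X * `|_|]gtr0_norm// -normrM mulrDr.
  rewrite (_ : q * dotp (x i) m = (q * dotp (x i) m - s) + s); last by ring.
  apply: le_trans (ler_normD _ _) _; apply: lerD => //.
  by rewrite ger0_norm// mulrC.
rewrite /y' dotpBr -/m.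
rewrite (_ : _ - _ - _ = (dotp (x i) (y j) - (M i j)%:R) - dotp (x i) m);
  last by ring.
apply: le_trans (ler_normB _ _) _; lra.
Qed.

End EnergyDecrement.

(** * Zero rectangles in sparse matrices with bounded factors *)

Section ZeroRectangle.
Variable F : realType.

Definition sparse (I J : finType) (M : I -> J -> bool)
    (R : {set I}) (C : {set J}) (eta : F) : Prop :=
  (forall i, i \in R -> #|[set k in C | M i k]|%:R <= eta * #|C|%:R) /\
  (forall j, j \in C -> #|[set i in R | M i j]|%:R <= eta * #|R|%:R).

Lemma sparse_le (I J : finType) (M : I -> J -> bool)
    (R : {set I}) (C : {set J}) eta eta' :
  eta <= eta' -> sparse M R C eta -> sparse M R C eta'.
Proof.
move=> le [h1 h2]; split=> k kin.
  by apply: le_trans (h1 _ kin) _; rewrite ler_wpM2r.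
by apply: le_trans (h2 _ kin) _; rewrite ler_wpM2r.
Qed.

(** Degrees do not increase in a subrectangle, while the side lengths shrink by a factor of at least
    [theta]. *)
Lemma sparse_sub (I J : finType) (M : I -> J -> bool)
    (R R1 : {set I}) (C C1 : {set J}) theta eta :
  0 < eta -> R1 \subset R -> C1 \subset C ->
  theta * #|R|%:R <= #|R1|%:R -> theta * #|C|%:R <= #|C1|%:R ->
  sparse M R C (eta * theta) -> sparse M R1 C1 eta.
Proof.
move=> eta0 sR sC hR hC [h1 h2].
split=> [i /(fintype.subsetP sR) iR|j /(fintype.subsetP sC) jC].
  apply: (@le_trans _ _ (#|[set k in C | M i k]|%:R)).
    rewrite ler_nat subset_leq_card//; apply/fintype.subsetP => k.
    by rewrite !inE => /andP[/(fintype.subsetP sC) -> ->].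
  by apply: le_trans (h1 _ iR) _; rewrite -mulrA ler_pM2l.
apply: (@le_trans _ _ (#|[set k in R | M k j]|%:R)).
  rewrite ler_nat subset_leq_card//; apply/fintype.subsetP => k.
  by rewrite !inE => /andP[/(fintype.subsetP sR) -> ->].
by apply: le_trans (h2 _ jC) _; rewrite -mulrA ler_pM2l.
Qed.

Lemma half_card (K : finType) (X Y : {set K}) (theta : F) :
  theta <= 1 / 2 -> (#|X| <= 2 * #|Y|)%N -> theta * #|X|%:R <= #|Y|%:R.
Proof.
move=> t2 h; have : theta * #|X|%:R <= 1 / 2 * #|X|%:R by rewrite ler_wpM2r.
move: h; rewrite -(ler_nat F) natrM; lra.
Qed.

(* Induction on the total energy X + Y, which each round lowers by 1/(8G). *)
Lemma sparse_zero_rectangle (G : F) (m : nat) : 0 < G ->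
  exists kappa eta eps : F, [/\ 0 < kappa, 0 < eta, 0 < eps &
    forall (I J : finType) (M : I -> J -> bool) (n : nat)
      (x : I -> 'rV[F]_n) (y : J -> 'rV[F]_n) (R : {set I}) (C : {set J})
      (X Y : F),
      X <= G -> Y <= G -> X + Y < m%:R * (1 / (8 * G)) ->
      factors M x y R C eps X Y -> sparse M R C eta ->
      exists (R' : {set I}) (C' : {set J}),
        [/\ R' \subset R, C' \subset C, kappa * #|R|%:R <= #|R'|%:R,
            kappa * #|C|%:R <= #|C'|%:R &
            forall i j, i \in R' -> j \in C' -> ~~ M i j]].
Proof.
move=> G0; elim: m => [|m [kappa [eta [eps [kappa0 eta0 eps0 IH]]]]].
  (* Here X + Y < 0, which the existence of both a row and a column would contradict; any constants
     do. *)
  exists 1, 1, 1; split=> // I J M n x y R C X Y _ _ XY [hX hY _] _.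
  exists R, C; rewrite !mul1r; split=> // i j /hX h1 /hY h2.
  by have := dotp_ge0 (x i); have := dotp_ge0 (y j); lra.
(* The choices give 2 eps' + rho <= eps for the next round. One side keeps rho / 8 (the cover) times
   1 / (8 G^2) (the low-energy part), the other side keeps one half; [theta] is below both. *)
pose rho := Num.min (eps / 2) (1 / 2).
pose eps' := Num.min (eps / 4) (1 / 2).
pose theta := Num.min (rho / (64 * G ^+ 2)) (1 / 2).
have rho0 : 0 < rho by rewrite lt_min !divr_gt0.
have rho2 : rho <= 1 / 2 by rewrite ge_min lexx orbT.
have rhoe : rho <= eps / 2 by rewrite ge_min lexx.
have eps'0 : 0 < eps' by rewrite lt_min !divr_gt0.
have eps'2 : eps' <= 1 / 2 by rewrite ge_min lexx orbT.
have eps'e : eps' <= eps / 4 by rewrite ge_min lexx.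
have G20 : 0 < G ^+ 2 by rewrite exprn_gt0.
have theta0 : 0 < theta by rewrite lt_min !divr_gt0// mulr_gt0.
have theta2 : theta <= 1 / 2 by rewrite ge_min lexx orbT.
have thetar : theta <= rho / (64 * G ^+ 2) by rewrite ge_min lexx.
exists (Num.min (kappa * theta) (1 / 2)), (Num.min (eta * theta) (rho / 8)), eps'.
split; rewrite ?lt_min ?mulr_gt0 ?divr_gt0//.
move=> I J M n x y R C X Y XG YG XY fac sp.
set kappa' := Num.min (kappa * theta) _.
have kappa'2 : kappa' <= 1 / 2 by rewrite ge_min lexx orbT.
have kappa'k : kappa' <= kappa * theta by rewrite ge_min lexx.
have sp8 : sparse M R C (rho / 8) by apply: sparse_le sp; rewrite ge_min lexx orbT.
have spt : sparse M R C (eta * theta) by apply: sparse_le sp; rewrite ge_min lexx.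
(* Either some rectangle with half of each side is already zero, or the greedy cover never gets
   stuck. *)
have [[R0 [C0 [[R0R C0C] [hR0 hC0 z]]]]|nz] := pselect
    (exists (R0 : {set I}) (C0 : {set J}), (R0 \subset R /\ C0 \subset C) /\
     [/\ (#|R| <= 2 * #|R0|)%N, (#|C| <= 2 * #|C0|)%N &
     forall i j, i \in R0 -> j \in C0 -> ~~ M i j]).
  by exists R0, C0; split=> //; apply: half_card.
have {nz} nz (R0 : {set I}) (C0 : {set J}) : R0 \subset R -> C0 \subset C ->
    (#|R| <= 2 * #|R0|)%N -> (#|C| <= 2 * #|C0|)%N ->
    exists i j, [/\ i \in R0, j \in C0 & M i j].
  move=> h1 h2 h3 h4; apply: contrapT => h; apply: nz; exists R0, C0.
  split; split=> // i j iR jC; apply/negP => Mij; apply: h.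
  by exists i, j.
have recurse (R1 : {set I}) (C1 : {set J})
      (x1 : I -> 'rV[F]_n) (y1 : J -> 'rV[F]_n) X1 Y1 :
    R1 \subset R -> C1 \subset C ->
    theta * #|R|%:R <= #|R1|%:R -> theta * #|C|%:R <= #|C1|%:R ->
    X1 <= G -> Y1 <= G -> X1 + Y1 <= X + Y - 1 / (8 * G) ->
    factors M x1 y1 R1 C1 (2 * eps' + rho) X1 Y1 ->
    exists (R' : {set I}) (C' : {set J}),
        [/\ R' \subset R, C' \subset C, kappa' * #|R|%:R <= #|R'|%:R,
            kappa' * #|C|%:R <= #|C'|%:R &
            forall i j, i \in R' -> j \in C' -> ~~ M i j].
  move=> R1R C1C hR hC X1G Y1G XY1 [f1 f2 f3].
  have [|||R' [C' [h1 h2 h3 h4 h5]]] := IH I J M n x1 y1 R1 C1 X1 Y1 X1G Y1G.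
  - by move: XY; rewrite -[m.+1]addn1 natrD; lra.
  - split=> // i j iR jC; apply: le_trans (f3 _ _ iR jC) _; lra.
  - exact: sparse_sub spt.
  exists R', C'; split=> //.
  - exact: fintype.subset_trans h1 R1R.
  - exact: fintype.subset_trans h2 C1C.
  - apply: le_trans h3; apply: le_trans (ler_wpM2r _ kappa'k) _ => //.
    by rewrite -mulrA ler_pM2l.
  - apply: le_trans h4; apply: le_trans (ler_wpM2r _ kappa'k) _ => //.
    by rewrite -mulrA ler_pM2l.
have large (K : finType) (A U B : {set K}) : rho / 8 * #|A|%:R <= #|U|%:R ->
    #|U|%:R <= 8 * G ^+ 2 * #|B|%:R -> theta * #|A|%:R <= #|B|%:R.
  move=> h1 h2; apply: le_trans (ler_wpM2r _ thetar) _ => //.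
  rewrite mulrAC ler_pdivrMr ?mulr_gt0//.
  have := le_trans h1 h2; lra.
have rho01 : 0 < rho <= 1 by rewrite rho0; lra.
have g0 : 0 < 1 / (8 * G) by rewrite divr_gt0// mulr_gt0.
have [[R0 [U [b dc]]]|[C0 [V [a dc]]]] := greedy_cover rho01 sp8.1 sp8.2 nz.
- have [C1 [y1 [C1U cU fac1]]] := energy_decrement dc fac G0 XG YG eps'2.
  have [/andP[R0R UC] hR0 hU _ _] := dc.
  apply: recurse fac1 => //; [exact: fintype.subset_trans UC |
    exact: half_card | exact: large cU | lra | lra].
- have [R1 [x1 [R1V cV fac1]]] := energy_decrement dc (factors_tr fac) G0 YG XG eps'2.
  have [/andP[C0C VR] hC0 hV _ _] := dc.
  apply: recurse (factors_tr fac1) => //; [exact: fintype.subset_trans VR |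
    exact: large cV | exact: half_card | lra | lra].
Qed.

End ZeroRectangle.

(** * From signs to a constant rectangle *)

Section SignRectangle.
Variable F : realType.

(* Perceptron: w sums signed columns, each of which it misclassifies on a
   proportion > eta of the current rows; restricting to those rows gives
   k tau <= <x i, w> <= sqrt k, so that k <= 1 / tau^2. *)
Lemma perceptron (I J : finType) (S : I -> J -> bool) (n : nat)
    (x : I -> 'rV[F]_n) (y : J -> 'rV[F]_n) (C : {set J}) (tau t eta : F)
    (m k : nat) (R : {set I}) (w : 'rV[F]_n) :
  0 < eta <= 1 -> 0 < tau <= t ->
  (forall i, i \in R -> dotp (x i) (x i) <= 1) ->
  (forall j, j \in C -> dotp (y j) (y j) <= 1) ->
  (forall i j, i \in R -> j \in C ->
     dotp (x i) (y j) = if S i j then t else - t) ->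
  dotp w w <= k%:R -> (forall i, i \in R -> k%:R * tau <= dotp (x i) w) ->
  1 < (k + m)%:R * tau ^+ 2 ->
  exists (R' : {set I}) (C' : {set J}) (s : bool),
    [/\ (R' \subset R) && (C' \subset C), eta ^+ m * #|R|%:R <= #|R'|%:R,
        (#|C| <= 2 * #|C'|)%N &
        forall j, j \in C' -> #|[set i in R' | S i j != s]|%:R <= eta * #|R'|%:R].
Proof.
move=> /andP[eta0 eta1] /andP[tau0 taut] hx hy.
elim: m => [|m IH] in k R w hx * => hS hw hR hk.
  (* A remaining row would give k^2 tau^2 <= k, against k tau^2 > 1. *)
  have R0 : R = finset.set0.
    apply/eqP; apply: contraPT isT => /finset.set0Pn[i iR].
    have k0 : 0 <= k%:R :> F by apply: ler0n.
    have h1 : (k%:R * tau) ^+ 2 <= dotp (x i) w ^+ 2.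
      rewrite lerXn2r ?hR// nnegrE ?mulr_ge0 ?(ltW tau0)//.
      by rewrite (le_trans _ (hR _ iR))// mulr_ge0// ltW.
    have h2 := sqr_dotp_le (x i) w.
    have h3 : dotp (x i) (x i) * dotp w w <= 1 * k%:R.
      by apply: ler_pM; rewrite ?dotp_ge0// hx.
    have := le_trans h1 (le_trans h2 h3); rewrite mul1r exprMn.
    move: hk; rewrite addn0 => hk.
    have kp : 0 < k%:R :> F.
      rewrite lt_neqAle k0 andbT eq_sym; apply/eqP => kE; move: hk.
      by rewrite kE mul0r ltr10.
    rewrite expr2 -mulrA -[leRHS]mulr1 ler_pM2l// => h.
    by have := lt_le_trans hk h; rewrite ltxx.
  exists R, C, true; split; rewrite ?fintype.subxx// ?R0 ?cards0 ?mulr0 ?leq_pmull//.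
  by move=> j _; rewrite card_setIdE big_set0 lexx.
pose e j := 0 <= dotp w (y j).
have [[j [jC hj]]|nj] := pselect (exists j, j \in C /\
    eta * #|R|%:R < #|[set i in R | S i j != e j]|%:R).
  set R1 := [set i in R | S i j != e j] in hj.
  have R1R : R1 \subset R by apply/fintype.subsetP => i; rewrite inE => /andP[].
  (* The update goes against the predicted sign, so the squared norm grows by at most 1; on the
     misclassified rows the product gains t >= tau. *)
  pose w1 := if e j then w - y j else w + y j.
  have [|||||R' [C' [s [/andP[h1 h2] h3 h4 h5]]]] := IH k.+1 R1 w1.
  - by move=> i /(fintype.subsetP R1R); apply: hx.
  - by move=> i j' /(fintype.subsetP R1R); apply: hS.
  - have := hy _ jC; rewrite /w1 -[k.+1]addn1 natrD.
    case: ifP => [|/negbT]; rewrite /e -?ltNge => ej.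
      by rewrite dotpBl !dotpBr (dotpC (y j) w); lra.
    by rewrite dotpDl !dotpDr (dotpC (y j) w); lra.
  - move=> i; rewrite inE => /andP[iR]; have := hR _ iR.
    have := hS _ _ iR jC; rewrite /w1 -[k.+1]addn1 natrD mulrDl mul1r.
    by case: (S i j); case: (e j) => // h1 h2 _; rewrite ?dotpBr ?dotpDr h1; lra.
  - by rewrite addSnnS.
  exists R', C', s; split=> //; first by rewrite h2 (fintype.subset_trans h1).
  apply: le_trans h3; rewrite exprSr -mulrA ler_wpM2l ?exprn_ge0 ?(ltW eta0)//.
  exact: ltW.
have hn j : j \in C -> #|[set i in R | S i j != e j]|%:R <= eta * #|R|%:R.
  by move=> jC; rewrite leNgt; apply/negP => h; apply: nj; exists j.
have em : eta ^+ m.+1 * #|R|%:R <= #|R|%:R.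
  by rewrite -[leRHS]mul1r ler_wpM2r// exprn_ile1// ltW.
(* With every column predicted well, the more frequent prediction supplies [s] and half of the
   columns. *)
have cC : (#|C| = #|[set j in C | e j]| + #|[set j in C | ~~ e j]|)%N.
  rewrite -(cardsID [set j | e j] C); congr (_ + _)%N; apply: eq_card => j;
  by rewrite !inE// andbC.
have [le|/ltnW le] := leqP #|[set j in C | e j]| #|[set j in C | ~~ e j]|.
  exists R, [set j in C | ~~ e j], false; split=> //.
  - by rewrite fintype.subxx; apply/fintype.subsetP => j; rewrite inE => /andP[].
  - by rewrite cC mul2n -addnn leq_add2r.
  - by move=> j; rewrite inE => /andP[jC /negbTE ej]; have := hn _ jC; rewrite ej.
exists R, [set j in C | e j], true; split=> //.
- by rewrite fintype.subxx; apply/fintype.subsetP => j; rewrite inE => /andP[].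
- by rewrite cC mul2n -addnn leq_add2l.
- by move=> j; rewrite inE => /andP[jC ej]; have := hn _ jC; rewrite ej.
Qed.

(** The perceptron controls columns only. By Markov's inequality at most half of the rows exceed
    twice the average bound; dropping them at most doubles relative column degrees. *)
Lemma sparse_prune (I J : finType) (M : I -> J -> bool)
    (R : {set I}) (C : {set J}) (eta : F) : 0 < eta ->
  (forall j, j \in C -> #|[set i in R | M i j]|%:R <= eta * #|R|%:R) ->
  exists R' : {set I}, [/\ R' \subset R, (#|R| <= 2 * #|R'|)%N &
    sparse M R' C (2 * eta)].
Proof.
move=> eta0 h; pose R' := [set i in R | #|[set k in C | M i k]|%:R <= 2 * eta * #|C|%:R].
have R'R : R' \subset R by apply/fintype.subsetP => i; rewrite inE => /andP[].
have cR' : (#|R| <= 2 * #|R'|)%N.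
  have [C0|C0] := eqVneq C finset.set0.
    rewrite (_ : R' = R) ?leq_pmull//; apply/finset.setP => i; rewrite inE.
    by rewrite card_setIdE C0 big_set0 cards0 mulr0 lexx andbT.
  have Cp : 0 < #|C|%:R :> F by rewrite ltr0n card_gt0.
  have h1 : #|R :\: R'|%:R * (2 * eta * #|C|%:R) <=
      (\sum_(i in R) #|[set k in C | M i k]|)%:R.
    rewrite natr_sum (big_setID R') /= -[leLHS]add0r; apply: lerD; first exact: sumr_ge0.
    rewrite mulr_natl -sumr_const; apply: ler_sum => i.
    by rewrite !inE => /andP[iR' iR]; move: iR'; rewrite iR /= -ltNge => /ltW.
  have h2 : (\sum_(i in R) #|[set k in C | M i k]|)%:R <= #|C|%:R * (eta * #|R|%:R).
    by rewrite double_count natr_sum mulr_natl -sumr_const; apply: ler_sum.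
  have h3 : 2 * #|R :\: R'|%:R <= #|R|%:R :> F.
    have ec : 0 < eta * #|C|%:R by rewrite mulr_gt0.
    by rewrite -(ler_pM2l ec); have := le_trans h1 h2; lra.
  move: h3; rewrite -natrM ler_nat -(cardsID R' R) (finset.setIidPr R'R); clear; lia.
exists R'; split=> //; split=> [i|j jC]; first by rewrite inE => /andP[].
apply: (@le_trans _ _ (#|[set i in R | M i j]|%:R)).
  rewrite ler_nat subset_leq_card//; apply/fintype.subsetP => i.
  by rewrite !inE => /andP[/andP[-> _] ->].
apply: le_trans (h _ jC) _; rewrite -mulrA mulrCA ler_pM2l//.
by rewrite -natrM ler_nat.
Qed.

Lemma nat_above (a b : F) : 0 < b -> exists m : nat, a < m%:R * b.
Proof.
move=> b0; exists (Num.bound (a / b)); rewrite -ltr_pdivrMr//.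
have [h|h] := leP 0 (a / b); first exact: archi_boundP.
exact: lt_le_trans h (ler0n _ _).
Qed.

Lemma sign_rectangle (tau : F) : 0 < tau ->
  exists2 c : F, 0 < c & forall (I J : finType) (S : I -> J -> bool) (n : nat)
    (x : I -> 'rV[F]_n) (y : J -> 'rV[F]_n) (t : F),
    tau <= t ->
    (forall i, dotp (x i) (x i) <= 1) -> (forall j, dotp (y j) (y j) <= 1) ->
    (forall i j, dotp (x i) (y j) = if S i j then t else - t) ->
    exists (R : {set I}) (C : {set J}) (s : bool),
      [/\ c * #|I|%:R <= #|R|%:R, c * #|J|%:R <= #|C|%:R &
          forall i j, i \in R -> j \in C -> S i j = s].
Proof.
move=> tau0; pose G : F := 2 + 1 / tau ^+ 2.
have tau20 : 0 < 1 / tau ^+ 2 by rewrite divr_gt0// exprn_gt0.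
have G0 : 0 < G by rewrite addr_gt0.
have [m hm] : exists m : nat, G + G < m%:R * (1 / (8 * G)).
  by apply: nat_above; rewrite divr_gt0// mulr_gt0.
have [kappa [eta [eps [kappa0 eta0 eps0 zero]]]] := sparse_zero_rectangle m G0.
have [k hk] : exists k : nat, 1 < k%:R * tau ^+ 2.
  by apply: nat_above; rewrite exprn_gt0.
pose eta' := Num.min (eta / 2) 1.
have eta'0 : 0 < eta' by rewrite lt_min divr_gt0 ?ltr01.

have eta'1 : eta' <= 1 by rewrite ge_min lexx orbT.
have eta'e : 2 * eta' <= eta.
  have : eta' <= eta / 2 by rewrite ge_min lexx.
  lra.
have ek0 : 0 < eta' ^+ k by rewrite exprn_gt0.
have ek1 : eta' ^+ k <= 1 by rewrite exprn_ile1// ltW.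
(* Rows lose eta'^k to the perceptron and a factor 2 to pruning; columns lose only a factor 2 before
   the zero rectangle costs [kappa]. *)
exists (kappa * (eta' ^+ k / 2)); first by rewrite mulr_gt0// divr_gt0.
move=> I J S n x y t taut hx hy hS.
have t0 : 0 < t by apply: lt_le_trans taut.
have [||||||||] := @perceptron I J S n x y [set: J] tau t eta' k 0 [set: I] 0.
- by rewrite eta'0.
- by rewrite tau0.
- by move=> i _.
- by move=> j _.
- by move=> i j _ _.
- by rewrite dotp0l.
- by move=> i _; rewrite mul0r dotpC dotp0l.
- by rewrite add0n.
move=> R1 [C1 [s [_ cR1 cC1 hs]]].
have [R2 [R21 cR2 sp]] := sparse_prune (M := fun i j => S i j != s) eta'0 hs.
(* The scaled product is -1/2 where the sign agrees with [s] and 1/2 where it does not; the extra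
   coordinate adds 1/2, so the exceptional matrix is factored exactly. *)
pose a : F := (if s then - 1 else 1) / (2 * t).
pose x' i : 'rV[F]_(n + 1) := row_mx (a *: x i) (const_mx (1 / 2)).
pose y' j : 'rV[F]_(n + 1) := row_mx (y j) (const_mx 1).
have dotp1 (p q : F) : dotp (const_mx p : 'rV_1) (const_mx q) = p * q.
  by rewrite /dotp big_ord1 !mxE.
have a2 : a ^+ 2 <= 1 / tau ^+ 2.
  have -> : a ^+ 2 = 1 / (4 * t ^+ 2).
    by rewrite /a; case: (s); field; rewrite gt_eqF.
  rewrite ler_pdivrMr ?mulr_gt0 ?exprn_gt0// mulrC mulrA.
  rewrite ler_pdivlMr ?exprn_gt0// mul1r mulr1.
  have : tau ^+ 2 <= t ^+ 2 by rewrite lerXn2r ?nnegrE ?(ltW tau0) ?(ltW t0).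
  have : 0 <= t ^+ 2 by apply: sqr_ge0.
  lra.
have [||] := zero I J (fun i j => S i j != s) _ x' y' R2 C1 G G (lexx _) (lexx _) hm.
- split=> [i _|j _|i j _ _].
  + rewrite dotp_row_mx dotp1 dotpZl dotpZr mulrA -expr2.
    have : a ^+ 2 * dotp (x i) (x i) <= a ^+ 2 * 1 by rewrite ler_wpM2l ?sqr_ge0.
    rewrite /G; lra.
  + by rewrite dotp_row_mx dotp1; have := hy j; rewrite /G; lra.
  + rewrite dotp_row_mx dotp1 dotpZl hS (_ : _ - _ = 0) ?normr0 ?ltW//.
    by rewrite /a; case: (S i j); case: (s) => /=; field; rewrite gt_eqF.
- exact: sparse_le sp.
move=> R [C [_ _ cR cC z]]; exists R, C, s; split.
- apply: le_trans cR; rewrite -mulrA ler_pM2l//.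
  move: cR1; rewrite cardsT; move: cR2; rewrite -(ler_nat F) natrM; lra.
- apply: le_trans cC; rewrite -mulrA ler_pM2l//.
  move: cC1; rewrite cardsT -(ler_nat F) natrM.
  have : eta' ^+ k * #|J|%:R <= 1 * #|J|%:R by rewrite ler_wpM2r.
  lra.
- by move=> i j iR jC; apply/eqP; rewrite -[_ == _]negbK z.
Qed.

End SignRectangle.

(** * From angles to signs of inner products *)

Section Angles.
Variables (F : realType) (n : nat).
Implicit Types u v : 'rV[F]_n.

Definition unit_vector v := (enorm v)^-1 *: v.

Lemma dotp_unit_vector u v :
  dotp (unit_vector u) (unit_vector v) = dotp u v / (enorm u * enorm v).
Proof. by rewrite dotpZl dotpZr mulrA -invfM mulrC. Qed.

Lemma cos_vangle u v : u != 0 -> v != 0 ->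
  cos (vangle u v) = dotp (unit_vector u) (unit_vector v).
Proof.
move=> u0 v0; rewrite dotp_unit_vector acosK//.
by rewrite in_itv /= cos_vangle_itv.
Qed.

Lemma dotp_unit_vector_self v : v != 0 ->
  dotp (unit_vector v) (unit_vector v) = 1.
Proof.
move=> v0; rewrite dotp_unit_vector -expr2 sqr_sqrtr ?dotp_ge0// divff//.
by rewrite dotp_eq0.
Qed.

End Angles.

(** Cosine decreases on [0, pi] and sin delta = cos (pi/2 - delta). This makes the margin [tau]
    depend on [delta] alone. *)
Lemma sin_le_cos (F : realType) (delta alpha : F) :
  0 < delta -> 0 <= alpha -> alpha < pi / 2 - delta ->
  sin delta <= cos alpha.
Proof.
move=> d0 a0 ad; have pi0 := pi_gt0 F.
rewrite -cosBpihalf -cosN opprB; apply/ltW.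
by rewrite ltr_cos// in_itv /=; apply/andP; split; lra.
Qed.

Theorem theorem2p5 (R : realType) (delta : R) (hdelta : 0 < delta) :
  exists2 c : R, 0 < c &
    forall (alpha : R), 0 <= alpha -> alpha < pi / 2 - delta ->
    forall (n : nat) (A B : {fset {vspace 'rV[R]_n}}),
      (forall l, l \in A `|` B -> is_line l) ->
      (forall l1 l2, l1 \in A -> l2 \in B -> line_angle l1 l2 = alpha) ->
    forall v : {vspace 'rV[R]_n} -> 'rV[R]_n,
      (forall l, l \in A `|` B -> direction_vector l (v l)) ->
    exists A' B' : {fset {vspace 'rV[R]_n}},
      [/\ A' `<=` A, B' `<=` B,
          c * #|` A|%:R <= #|` A'|%:R,
          c * #|` B|%:R <= #|` B'|%:R &
          (forall l1 l2, l1 \in A' -> l2 \in B' ->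
             vangle (v l1) (v l2) = alpha) \/
          (forall l1 l2, l1 \in A' -> l2 \in B' ->
             vangle (v l1) (v l2) = pi - alpha)].
Proof.
have pi0 := pi_gt0 R.
(* For delta >= pi/2 no [alpha] is admissible. *)
have [dpi|dpi] := leP (pi / 2) delta; first by exists 1 => // alpha a0 ad; lra.
have sd : 0 < sin delta by apply: sin_gt0_pi; rewrite hdelta; lra.
have [c c0 rect] := sign_rectangle sd; exists c => // alpha a0 ad n A B _ angAB v dirv.
have v0 l : l \in A `|` B -> v l != 0 by case/dirv.
have vA (l : A) : v (fsval l) != 0 by apply: v0; rewrite in_fsetU fsvalP.
have vB (l : B) : v (fsval l) != 0 by apply: v0; rewrite in_fsetU fsvalP orbT.
have dich (k : A) (l : B) : vangle (v (fsval k)) (v (fsval l)) != alpha ->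
    vangle (v (fsval k)) (v (fsval l)) = pi - alpha.
  have := angAB _ _ (fsvalP k) (fsvalP l).
  rewrite (line_angleE (dirv _ _) (dirv _ _)) ?in_fsetU ?fsvalP ?orbT//.
  by rewrite /Num.min; case: ifP => [_ ->|_ <- _]; rewrite ?eqxx ?subKr.
(* The sign records whether the angle is [alpha]; otherwise it is pi - alpha, whose cosine is the
   opposite. *)
have [|||| A1 [B1 [s [cA cB hs]]]] := rect A B
  (fun k l => vangle (v (fsval k)) (v (fsval l)) == alpha) n
  (fun k => unit_vector (v (fsval k))) (fun l => unit_vector (v (fsval l)))
  (cos alpha).
- exact: sin_le_cos.
- by move=> k; rewrite dotp_unit_vector_self.
- by move=> l; rewrite dotp_unit_vector_self.
- move=> k l; rewrite -cos_vangle//; case: eqP => [->//|/eqP/dich ->].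
  by rewrite cosB cospi sinpi mulN1r mul0r addr0.
exists [fset fsval k | k in A1], [fset fsval l | l in B1]; split.
- by apply/fsubsetP => _ /imfsetP[k _ ->]; apply: fsvalP.
- by apply/fsubsetP => _ /imfsetP[l _ ->]; apply: fsvalP.
- by rewrite card_imfset ?cardfE -?cardE//; apply: val_inj.
- by rewrite card_imfset ?cardfE -?cardE//; apply: val_inj.
case: s hs => hs; [left|right] => _ _ /imfsetP[k kA ->] /imfsetP[l lB ->].
  by apply/eqP; rewrite hs.
by apply: dich; rewrite hs.
Qed.
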